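(* Let $\mathfrak{A}$ be a unital bornological algebra, $S\triangleleft\ell^\infty$ a symmetric ideal, and $I_{S(\mathfrak{A})}=\mathrm{span}\{\mathrm{diag}(\alpha)U_f:\alpha\in S(\mathfrak{A}),\ f\in\mathrm{Emb}\}$, an ideal of $\Gamma^\infty(\mathfrak{A})=\mathrm{span}\{\mathrm{diag}(\alpha)U_f:\alpha\in\ell^\infty(\mathfrak{A}),\ f\in\mathrm{Emb}\}\subset\mathcal{B}(\ell^2(\mathfrak{A}))$. Then, identifying operators with matrices, $$I_{S(\mathfrak{A})}=\{A=(A_{ij})_{i,j\in\mathbb{N}}:\ \{A_{ij}\}\in S(\mathbb{N}\times\mathbb{N},\mathfrak{A})\ \text{and}\ N(A)<\infty\}.$$
   Context: A (complete, convex) bornological vector space over $\mathbb{C}$ is a filtering union $\mathbb{V}=\bigcup_D\mathbb{V}_D$ of Banach spaces, indexed by the disks $D$ of $\mathbb{V}$, with bounded inclusions; $\|\cdot\|_D$ is the norm of $\mathbb{V}_D$. A bornological algebra is a bornological vector space with an associative bounded multiplication. $\mathrm{Emb}$ is the monoid of partially defined injections $f:\mathrm{dom}(f)\to\mathbb{N}$, $\mathrm{dom}(f)\subset\mathbb{N}$, with inverse $f^\dagger:\mathrm{ran}(f)\to\mathbb{N}$; it acts on bounded sequences by $f_*(\alpha)_n=\alpha_{f^\dagger(n)}$ if $n\in\mathrm{ran}(f)$, $0$ otherwise. An ideal $S$ of $\ell^\infty=\ell^\infty(\mathbb{N},\mathbb{C})$ is symmetric if it is invariant under this action. For a countably infinite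 set $X$, $S(X)$ is obtained from $S$ by transport along any bijection $\mathbb{N}\to X$, and $S(X,\mathfrak{A})$ is the set of families $(a_x)_{x\in X}$ contained in some $\mathfrak{A}_D$ with $(\|a_x\|_D)_x\in S(X)$; $S(\mathfrak{A})=S(\mathbb{N},\mathfrak{A})$. $\ell^2(\mathfrak{A})$ is the space of sequences $\xi$ in some $\mathfrak{A}_D$ with $\sum_n\|\xi_n\|_D^2<\infty$; on it $\mathrm{diag}(\alpha)(\xi)=(\alpha_n\xi_n)_n$, and $U_f(\xi)_m=\xi_n$ if $f(n)=m$, $U_f(\xi)_m=0$ if $m\notin\mathrm{ran}(f)$. With $e_n\in\ell^2(\mathfrak{A})$, $(e_n)_i=\delta_{n,i}$, a right $\mathfrak{A}$-linear operator $A$ is identified with the matrix given by $Ae_n=\sum_kA_{kn}e_k$. $N(A)\in\mathbb{N}\cup\{\infty\}$ is the supremum of the numbers of nonzero entries in the rows and in the columns of $A$. *)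

(* Defs.v *)
From HB Require Import structures.
From mathcomp Require Import all_boot all_order all_algebra.
From mathcomp Require Import complex ring.
From mathcomp Require Import all_classical all_reals all_analysis.

Set Implicit Arguments.
Unset Strict Implicit.
Unset Printing Implicit Defensive.

Import Order.TTheory GRing.Theory Num.Theory.
Import numFieldNormedType.Exports.

Local Open Scope classical_set_scope.
Local Open Scope ring_scope.
Local Open Scope complex_scope.

(** The field of complex numbers is [R[i]] with [R : realType]. Norms of complex
    normed spaces take values in [R[i]]; [rnorm] is the same number in [R]. *)

Definition rnorm (R : realType) (V : normedZmodType R[i]) (x : V) : R :=
  complex.Re `|x|.

(** The image of [i1] is contained in the image of [i2], and the inclusion is
    bounded for the norms of [B1] and [B2]. *)
Definition bounded_inclusion (R : realType) (V : Type)
    (B1 B2 : normedModType R[i]) (i1 : B1 -> V) (i2 : B2 -> V) : Prop :=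
  exists C : R, forall x, exists2 y, i2 y = i1 x & rnorm y <= C * rnorm x.

(** Complete convex bornological vector spaces. The Banach space attached to a
    disk [D] is given as an abstract Banach space [disk_space D] with an
    injection [disk_incl D] into [V]. *)
HB.mixin Record isBornologicalVect (R : realType) V of GRing.Lmodule R[i] V := {
  disk : Type;
  disk_space : disk -> completeNormedModType R[i];
  disk_incl : forall D : disk, {linear disk_space D -> V};
  disk_incl_inj : forall D, injective (disk_incl D);
  disk_cover : forall v : V, exists D x, disk_incl D x = v;
  disk_filtering : forall D1 D2, exists D,
    bounded_inclusion (disk_incl D1) (disk_incl D) /\
    bounded_inclusion (disk_incl D2) (disk_incl D)
}.

#[short(type="bornVectType")]
HB.structure Definition BornologicalVect (R : realType) :=
  {V of GRing.Lmodule R[i] V & isBornologicalVect R V}.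

(** The library's [algType] only covers nonzero rings, and an algebra is allowed
    to be zero here: the multiplication is therefore part of the structure. *)
HB.mixin Record isBornologicalAlgebra (R : realType) A
    of BornologicalVect R A := {
  born_mul : A -> A -> A;
  born_one : A;
  born_mulA : associative born_mul;
  born_mul1l : left_id born_one born_mul;
  born_mul1r : right_id born_one born_mul;
  born_mull_linear : forall b, linear (born_mul^~ b);
  born_mulr_linear : forall a, linear (born_mul a);
  born_mul_bounded : forall D1 D2 : @disk R A, exists (D : @disk R A) (C : R),
    forall x y, exists2 z,
      disk_incl D z = born_mul (disk_incl D1 x) (disk_incl D2 y) &
      rnorm z <= C * (rnorm x * rnorm y)
}.

#[short(type="bornAlgType")]
HB.structure Definition BornologicalAlgebra (R : realType) :=
  {A of BornologicalVect R A & isBornologicalAlgebra R A}.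

(** Partially defined injections of [nat]; [None] means "undefined". *)
Record Emb := MkEmb {
  emb_fun :> nat -> option nat;
  emb_inj : forall m n k, emb_fun m = Some k -> emb_fun n = Some k -> m = n
}.

Definition emb_dagger (f : Emb) (m : nat) : option nat :=
  if pselect (exists n, f n = Some m) is left h then Some (projT1 (cid h))
  else None.

Lemma emb_daggerP (f : Emb) m n : emb_dagger f m = Some n <-> f n = Some m.
Proof.
rewrite /emb_dagger; case: pselect => [h|h]; last first.
  by split=> // fn; case: h; exists n.
case: (cid h) => k fk /=; split=> [[<-]//|fn].
by congr Some; exact: emb_inj fk fn.
Qed.

(** Both [f_*] on scalar sequences and [U_f] on vector sequences are given by
    this formula. *)
Definition emb_act (V : nmodType) (f : Emb) (u : nat -> V) : nat -> V :=
  fun m => if emb_dagger f m is Some n then u n else 0.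

Definition bounded_family (R : realType) (X : Type) (u : X -> R[i]) : Prop :=
  exists M : R, forall x, rnorm (u x) <= M.

Record symmetric_ideal (R : realType) (S : set (nat -> R[i])) : Prop := {
  symid_bounded : forall u, S u -> bounded_family u;
  symid0 : S (fun=> 0);
  symidD : forall u v, S u -> S v -> S (fun n => u n + v n);
  symidM : forall b u, bounded_family b -> S u -> S (fun n => b n * u n);
  symid_act : forall (f : Emb) u, S u -> S (emb_act f u)
}.

(** [S(X)], for [X] countably infinite. For a symmetric ideal [S] the condition
    does not depend on the bijection. *)
Definition transport (R : realType) (S : set (nat -> R[i])) (X : Type) :
    set (X -> R[i]) :=
  [set u : X -> R[i] | exists2 phi : nat -> X, bijective phi & S (u \o phi)].
Arguments transport {R} S X.

Definition disk_family (R : realType) (A : bornVectType R) (X : Type)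
    (P : set (X -> R[i])) : set (X -> A) :=
  [set a | exists (D : @disk R A) (b : X -> disk_space D),
    (forall x, disk_incl D (b x) = a x) /\ P (fun x => `|b x|)].
Arguments disk_family {R} A {X} P.

Definition ideal_family (R : realType) (S : set (nat -> R[i])) (X : Type)
    (A : bornVectType R) : set (X -> A) :=
  disk_family A (transport S X).
Arguments ideal_family {R} S X A.

Definition l2sq (R : realType) (V : normedZmodType R[i]) (x : nat -> V) :
    \bar R :=
  (\sum_(n <oo) ((rnorm (x n)) ^+ 2)%:E)%E.

Section RnormTheory.
Variable R : realType.
Implicit Types V W : normedZmodType R[i].

Lemma rnormE V (x : V) : (rnorm x)%:C = `|x|.
Proof. by rewrite /rnorm RRe_real// ger0_real. Qed.

Lemma rnorm_ge0 V (x : V) : 0 <= rnorm x.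
Proof. by rewrite -lecR rnormE normr_ge0. Qed.

Lemma rnorm_id V (x : V) : rnorm `|x| = rnorm x.
Proof. by rewrite /rnorm normr_id. Qed.

Lemma rnorm0 V : rnorm (0 : V) = 0.
Proof. by rewrite /rnorm normr0. Qed.

Lemma rnormD V (x y : V) : rnorm (x + y) <= rnorm x + rnorm y.
Proof. by rewrite -lecR rmorphD/= !rnormE ler_normD. Qed.

Lemma rnormZ (V : normedModType R[i]) (c : R[i]) (x : V) :
  rnorm (c *: x) = rnorm c * rnorm x.
Proof. by apply: complexI; rewrite rmorphM/= !rnormE normrZ. Qed.

Lemma l2sq_ge0 V (x : nat -> V) : (0 <= l2sq x)%E.
Proof. by apply: nneseries_ge0 => n _ _; rewrite lee_fin sqr_ge0. Qed.

Lemma l2sq_norm V (x : nat -> V) : l2sq (fun n => `|x n|) = l2sq x.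
Proof. by apply: eq_eseriesr => n _; rewrite rnorm_id. Qed.

Lemma l2sq_le V W (x : nat -> V) (y : nat -> W) (C : R) :
  (forall n, rnorm (y n) <= C * rnorm (x n)) ->
  (l2sq y <= (C ^+ 2)%:E * l2sq x)%E.
Proof.
move=> h; rewrite /l2sq -nneseriesZl; last by move=> n _; rewrite lee_fin sqr_ge0.
apply: lee_nneseries => [n _ _|n _]; first by rewrite lee_fin sqr_ge0.
rewrite -EFinM lee_fin -exprMn ler_pXn2r// ?nnegrE ?rnorm_ge0//.
exact: le_trans (rnorm_ge0 _) (h n).
Qed.

Lemma l2sqD V (x y : nat -> V) :
  (l2sq (fun n => x n + y n)%R <= 2%:E * (l2sq x + l2sq y))%E.
Proof.
rewrite /l2sq -nneseriesD; last 2 first.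
- by move=> n _ _; rewrite lee_fin sqr_ge0.
- by move=> n _ _; rewrite lee_fin sqr_ge0.
rewrite -nneseriesZl; last first.
  by move=> n _; rewrite -EFinD lee_fin addr_ge0// sqr_ge0.
apply: lee_nneseries => [n _ _|n _]; first by rewrite lee_fin sqr_ge0.
rewrite -EFinD -EFinM lee_fin.
have h := rnormD (x n) (y n); have h0 := rnorm_ge0 (x n + y n).
apply: (@le_trans _ _ ((rnorm (x n) + rnorm (y n)) ^+ 2)).
  by rewrite ler_pXn2r// nnegrE ?addr_ge0 ?rnorm_ge0.
rewrite -subr_ge0; set a := rnorm (x n); set b := rnorm (y n).
have -> : 2 * (a ^+ 2 + b ^+ 2) - (a + b) ^+ 2 = (a - b) ^+ 2.
  by rewrite sqrrD sqrrB; ring.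
exact: sqr_ge0.
Qed.

Lemma l2sq_emb V (f : Emb) (x : nat -> V) : (l2sq (emb_act f x) <= l2sq x)%E.
Proof.
have ge0 (y : nat -> V) n : (0 <= (rnorm (y n) ^+ 2)%:E)%E.
  by rewrite lee_fin sqr_ge0.
rewrite /l2sq !nneseries_esumT//; try by move=> n; exact: ge0.
pose P := [set m | emb_dagger f m != None].
pose e m := odflt 0%N (emb_dagger f m).
have einj : {in P &, injective e}.
  move=> m m' /set_mem; rewrite /P/= => hm /set_mem; rewrite /P/= => hm'.
  rewrite /e.
  case E : (emb_dagger f m) hm => [n|//] _.
  case E' : (emb_dagger f m') hm' => [n'|//] _ /= nn'; subst n'.
  move/emb_daggerP: E; move/emb_daggerP: E' => -> [] //.
rewrite (_ : \esum_(i in setT) _ =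
             \esum_(i in P) (rnorm (x (e i)) ^+ 2)%:E)%E; last first.
  rewrite [RHS]esum_mkcond; apply: eq_esum => m _.
  rewrite /emb_act /e; case: ifPn => [/set_mem|/negP hP].
    by rewrite /P/=; case: emb_dagger.
  case E : emb_dagger => [n|]; last by rewrite rnorm0 expr0n.
  by case: hP; apply/mem_set; rewrite /P/= E.
rewrite -(@reindex_esum R _ _ P (e @` P) e (fun i => (rnorm (x i) ^+ 2)%:E)).
- rewrite esum_mkcond; apply: le_esum => i _.
  by case: ifPn => //; exact: ge0.
- exact: inj_bij.
Qed.

End RnormTheory.

Section Lift.
Variables (R : realType) (A : bornVectType R).

Lemma lift_choice (X : Type) (D : @disk R A) (a : X -> A) (h : X -> R) :
  (forall x, exists2 y, disk_incl D y = a x & rnorm y <= h x) ->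
  exists b : X -> disk_space D,
    forall x, disk_incl D (b x) = a x /\ rnorm (b x) <= h x.
Proof.
move=> H; have {}H x : exists y, disk_incl D y = a x /\ rnorm y <= h x.
  by have [y] := H x; exists y.
by have [b Hb] := choice H; exists b.
Qed.

Lemma lift_inclusion (X : Type) (D D' : @disk R A) (b : X -> disk_space D) :
  bounded_inclusion (disk_incl D) (disk_incl D') ->
  exists (b' : X -> disk_space D') (C : R), forall x,
    disk_incl D' (b' x) = disk_incl D (b x) /\ rnorm (b' x) <= C * rnorm (b x).
Proof.
move=> [C h]; have [b' Hb'] := lift_choice (fun x => h (b x)).
by exists b', C.
Qed.

End Lift.

Section Ell2.
Variables (R : realType) (A : bornAlgType R).
Local Notation "a ** b" := (born_mul a b) (at level 40).

Lemma lift_mul (X : Type) (D1 D2 D : @disk R A) (C : R)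
    (b1 : X -> disk_space D1) (b2 : X -> disk_space D2) :
  (forall x y, exists2 z, disk_incl D z = disk_incl D1 x ** disk_incl D2 y &
     rnorm z <= C * (rnorm x * rnorm y)) ->
  exists b : X -> disk_space D, forall x,
    disk_incl D (b x) = disk_incl D1 (b1 x) ** disk_incl D2 (b2 x) /\
    rnorm (b x) <= C * (rnorm (b1 x) * rnorm (b2 x)).
Proof. by move=> h; apply: lift_choice => x; exact: h. Qed.

Lemma born_mulDl (a b c : A) : (a + b) ** c = a ** c + b ** c.
Proof. by have := born_mull_linear c 1 a b; rewrite !scale1r. Qed.

Lemma born_mulDr (a b c : A) : a ** (b + c) = a ** b + a ** c.
Proof. by have := born_mulr_linear a 1 b c; rewrite !scale1r. Qed.

Lemma born_mul0l (a : A) : 0 ** a = 0.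
Proof. by apply: (addIr (0 ** a)); rewrite -born_mulDl !add0r. Qed.

Lemma born_mul0r (a : A) : a ** 0 = 0.
Proof. by apply: (addIr (a ** 0)); rewrite -born_mulDr !add0r. Qed.

Lemma born_mulZl (k : R[i]) (a b : A) : (k *: a) ** b = k *: (a ** b).
Proof. by have := born_mull_linear b k a 0; rewrite born_mul0l !addr0. Qed.

Lemma born_mulZr (k : R[i]) (a b : A) : a ** (k *: b) = k *: (a ** b).
Proof. by have := born_mulr_linear a k b 0; rewrite born_mul0r !addr0. Qed.

Definition ell2_pred : {pred nat -> A} :=
  fun xi => `[< disk_family A [set u | (l2sq u < +oo)%E] xi >].

Record ell2 := MkEll2 { ell2_seq :> nat -> A; ell2P : ell2_seq \in ell2_pred }.

HB.instance Definition _ := [isSub for ell2_seq].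
HB.instance Definition _ := [Choice of ell2 by <:].

Lemma mem_ell2 (xi : nat -> A) (D : @disk R A) (x : nat -> disk_space D) :
  (forall n, disk_incl D (x n) = xi n) -> (l2sq x < +oo)%E -> xi \in ell2_pred.
Proof. by move=> h hx; apply/asboolP; exists D, x; split=> //=; rewrite l2sq_norm. Qed.

Lemma ell2_lift (xi : nat -> A) : xi \in ell2_pred ->
  exists (D : @disk R A) (x : nat -> disk_space D),
    (forall n, disk_incl D (x n) = xi n) /\ (l2sq x < +oo)%E.
Proof. by move/asboolP => [D [x [h hx]]]; exists D, x; move: hx; rewrite /= l2sq_norm. Qed.

Lemma l2sq_le_fin (V W : normedZmodType R[i]) (x : nat -> V) (y : nat -> W)
    (C : R) :
  (l2sq y <= C%:E * l2sq x)%E -> (l2sq x < +oo)%E -> (l2sq y < +oo)%E.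
Proof.
move=> h hx; apply: le_lt_trans h _.
have : l2sq x \is a fin_num by rewrite ge0_fin_numE// l2sq_ge0.
by move/fineK <-; rewrite -EFinM ltry.
Qed.

Lemma ell2_submod_closed : submod_closed ell2_pred.
Proof.
split.
  have [D [x _]] := @disk_cover R A 0.
  apply: (@mem_ell2 _ D (fun=> 0)) => [n|]; first by rewrite linear0.
  by rewrite /l2sq eseries0// => n _ _; rewrite rnorm0 expr0n.
move=> c xi1 xi2 /ell2_lift[D1 [x1 [hx1 s1]]] /ell2_lift[D2 [x2 [hx2 s2]]].
have [D [i1 i2]] := disk_filtering D1 D2.
have [y1 [C1 h1]] := lift_inclusion x1 i1.
have [y2 [C2 h2]] := lift_inclusion x2 i2.
apply: (@mem_ell2 _ D (fun n => c *: y1 n + y2 n)) => [n|].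
  by rewrite linearP (h1 n).1 (h2 n).1 hx1 hx2.
apply: le_lt_trans (l2sqD _ _) _.
have f1 : l2sq (fun n => c *: y1 n) \is a fin_num.
  rewrite ge0_fin_numE ?l2sq_ge0//; apply: l2sq_le_fin s1.
  apply: (l2sq_le (C := rnorm c * C1)) => n; rewrite rnormZ -mulrA.
  by rewrite ler_wpM2l ?rnorm_ge0// (h1 n).2.
have f2 : l2sq y2 \is a fin_num.
  rewrite ge0_fin_numE ?l2sq_ge0//; apply: l2sq_le_fin s2.
  by apply: l2sq_le => n; exact: (h2 n).2.
by rewrite -(fineK f1) -(fineK f2) -EFinD -EFinM ltry.
Qed.

HB.instance Definition _ := GRing.isSubmodClosed.Build _ _ ell2_pred
  ell2_submod_closed.
HB.instance Definition _ := [SubChoice_isSubLmodule of ell2 by <:].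

Lemma ell2_delta_subproof (n : nat) :
  (fun i => if i == n then born_one else 0 : A) \in ell2_pred.
Proof.
have [D [x hx]] := @disk_cover R A born_one.
apply: (@mem_ell2 _ D (fun i => if i == n then x else 0)) => [i|].
  by case: ifP => // _; rewrite linear0.
rewrite /l2sq (@sequences.nneseriesD1 R _ n xpredT)//; last first.
  by move=> k _; rewrite lee_fin sqr_ge0.
rewrite eqxx eseries0 ?adde0 ?ltry// => k _ /= /negPf ->.
by rewrite rnorm0 expr0n.
Qed.

Definition ell2_delta (n : nat) : ell2 := MkEll2 (ell2_delta_subproof n).

Lemma ell2_rmul_subproof (xi : ell2) (a : A) :
  (fun n => ell2_seq xi n ** a) \in ell2_pred.
Proof.
have [D1 [x [hx s]]] := ell2_lift (ell2P xi).
have [D2 [y hy]] := disk_cover a.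
have [D [C hm]] := born_mul_bounded D1 D2.
have [z hz] := lift_mul x (fun=> y) hm.
apply: (@mem_ell2 _ D z) => [n|]; first by rewrite (hz n).1 hx hy.
apply: l2sq_le_fin s; apply: (l2sq_le (C := C * rnorm y)) => n.
by rewrite (le_trans (hz n).2)// [rnorm y]lock mulrAC mulrA.
Qed.

Definition ell2_rmul (xi : ell2) (a : A) : ell2 :=
  MkEll2 (ell2_rmul_subproof xi a).

(** [T] maps bounded subsets of [ell2] to bounded subsets: for each disk [D] it
    maps [ell2(A_D)] boundedly into some [ell2(A_D')]. The bound is written for
    the squares of the norms. *)
Definition ell2_bounded (T : ell2 -> ell2) : Prop :=
  forall D : @disk R A, exists (D' : @disk R A) (C : R),
    forall (xi : ell2) (x : nat -> disk_space D),
      (forall n, disk_incl D (x n) = xi n) -> (l2sq x < +oo)%E ->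
      exists2 y : nat -> disk_space D',
        (forall n, disk_incl D' (y n) = T xi n) & (l2sq y <= C%:E * l2sq x)%E.

Definition bop_pred : {pred ell2 -> ell2} := fun T =>
  `[< [/\ ell2_bounded T, linear T &
          forall xi a, T (ell2_rmul xi a) = ell2_rmul (T xi) a] >].

(** [B(ell2(A))]; right [A]-linearity is part of the definition because
    operators are represented by their matrices. *)
Record bop := MkBop { bop_fun :> ell2 -> ell2; bopP : bop_fun \in bop_pred }.

HB.instance Definition _ := [isSub for bop_fun].
HB.instance Definition _ := [Choice of bop by <:].

Lemma ell2_eqP (xi eta : ell2) : (forall n, xi n = eta n) -> xi = eta.
Proof. by move=> h; apply: val_inj; exact: funext. Qed.

Lemma ell2_linE (c : R[i]) (xi eta : ell2) n :
  (c *: xi + eta) n = c *: xi n + eta n.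
Proof. by []. Qed.

Lemma bop_submod_closed : submod_closed bop_pred.
Proof.
split.
  apply/asboolP; split.
  - move=> D; exists D, 0 => xi x _ _; exists (fun=> 0) => [n|].
      by rewrite linear0.
    by rewrite mul0e /l2sq eseries0// => n _ _; rewrite rnorm0 expr0n.
  - by move=> c xi eta; rewrite scaler0 addr0.
  - by move=> xi a; apply: ell2_eqP => n /=; rewrite born_mul0l.
move=> c T1 T2 /asboolP[b1 l1 r1] /asboolP[b2 l2 r2]; apply/asboolP; split.
- move=> D; have [D1 [C1 h1]] := b1 D; have [D2 [C2 h2]] := b2 D.
  have [D' [i1 i2]] := disk_filtering D1 D2.
  have [K1 k1] := i1; have [K2 k2] := i2.
  exists D', (2 * ((rnorm c * K1) ^+ 2 * C1 + K2 ^+ 2 * C2)) => xi x hx sx.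
  have [y1 hy1 s1] := h1 xi x hx sx; have [y2 hy2 s2] := h2 xi x hx sx.
  have [z1 hz1] := lift_choice (fun n => k1 (y1 n)).
  have [z2 hz2] := lift_choice (fun n => k2 (y2 n)).
  exists (fun n => c *: z1 n + z2 n) => [n|].
    by rewrite linearP (hz1 n).1 (hz2 n).1 hy1 hy2.
  apply: le_trans (l2sqD _ _) _.
  have sxf : l2sq x \is a fin_num by rewrite ge0_fin_numE// l2sq_ge0.
  rewrite EFinM -muleA; apply: lee_wpmul2l; first by rewrite lee_fin.
  rewrite EFinD muleDl//; apply: leeD.
    apply: (@le_trans _ _ (((rnorm c * K1) ^+ 2)%:E * l2sq y1)%E).
      apply: l2sq_le => n; rewrite rnormZ -mulrA.
      by rewrite ler_wpM2l ?rnorm_ge0// (hz1 n).2.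
    rewrite [X in (_ <= X * _)%E]EFinM -muleA lee_wpmul2l//.
    by rewrite lee_fin sqr_ge0.
  apply: (@le_trans _ _ ((K2 ^+ 2)%:E * l2sq y2)%E).
    by apply: l2sq_le => n; exact: (hz2 n).2.
  rewrite [X in (_ <= X * _)%E]EFinM -muleA lee_wpmul2l//.
  by rewrite lee_fin sqr_ge0.
- move=> k xi eta; rewrite /= !fctE l1 l2 !scalerDr !scalerA mulrC.
  by rewrite -!addrA; congr (_ + _); rewrite addrCA.
- move=> xi a; rewrite !fctE r1 r2; apply: ell2_eqP => n /=.
  by rewrite !fctE /= born_mulDl born_mulZl.
Qed.

HB.instance Definition _ := GRing.isSubmodClosed.Build _ _ bop_pred
  bop_submod_closed.
HB.instance Definition _ := [SubChoice_isSubLmodule of bop by <:].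

Lemma bop_comp_subproof (S T : bop) : S \o T \in bop_pred.
Proof.
case: S T => [S /= /asboolP[bS lS rS]] [T /= /asboolP[bT lT rT]].
apply/asboolP; split.
- move=> D; have [D1 [C1 h1]] := bT D; have [D2 [C2 h2]] := bS D1.
  exists D2, (Num.max C2 0 * C1) => xi x hx sx.
  have [y hy sy] := h1 xi x hx sx.
  have [z hz sz] := h2 _ y hy (l2sq_le_fin sy sx).
  exists z => //; apply: le_trans sz _.
  apply: (@le_trans _ _ ((Num.max C2 0)%:E * l2sq y)%E).
    by rewrite lee_wpmul2r ?l2sq_ge0// lee_fin le_max lexx.
  by rewrite EFinM -muleA lee_wpmul2l// lee_fin le_max lexx orbT.
- by move=> k xi eta /=; rewrite lT lS.
- by move=> xi a /=; rewrite rT rS.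
Qed.

Definition bop_comp (S T : bop) : bop := MkBop (bop_comp_subproof S T).

Record ell_infty := MkEllInfty {
  ell_infty_seq :> nat -> A;
  ell_inftyP : disk_family A (@bounded_family R nat) ell_infty_seq
}.

Lemma diag_ell2_subproof (alpha : ell_infty) (xi : ell2) :
  (fun n => ell_infty_seq alpha n ** ell2_seq xi n) \in ell2_pred.
Proof.
have [D1 [a [ha [M hM]]]] := ell_inftyP alpha.
have [D2 [x [hx s]]] := ell2_lift (ell2P xi).
have [D [C hm]] := born_mul_bounded D1 D2.
have [z hz] := lift_mul a x hm.
apply: (@mem_ell2 _ D z) => [n|]; first by rewrite (hz n).1 hx ha.
apply: l2sq_le_fin s; apply: (l2sq_le (C := Num.max C 0 * M)) => n.
apply: le_trans (hz n).2 _.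
have := hM n; rewrite rnorm_id => hMn.
apply: (@le_trans _ _ (Num.max C 0 * (rnorm (a n) * rnorm (x n)))).
  by rewrite ler_wpM2r ?mulr_ge0 ?rnorm_ge0// le_max lexx.
rewrite -mulrA ler_wpM2l ?le_max ?lexx ?orbT//.
by rewrite ler_wpM2r ?rnorm_ge0.
Qed.

Definition diag_ell2 (alpha : ell_infty) (xi : ell2) : ell2 :=
  MkEll2 (diag_ell2_subproof alpha xi).

Lemma diag_subproof (alpha : ell_infty) : diag_ell2 alpha \in bop_pred.
Proof.
apply/asboolP; split.
- move=> D2; have [D1 [a [ha [M hM]]]] := ell_inftyP alpha.
  have [D [C hm]] := born_mul_bounded D1 D2.
  exists D, ((Num.max C 0 * M) ^+ 2) => xi x hx _.
  have [z hz] := lift_mul a x hm.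
  exists z => [n|]; first by rewrite (hz n).1 hx ha.
  apply: l2sq_le => n; apply: le_trans (hz n).2 _.
  have := hM n; rewrite rnorm_id => hMn.
  apply: (@le_trans _ _ (Num.max C 0 * (rnorm (a n) * rnorm (x n)))).
    by rewrite ler_wpM2r ?mulr_ge0 ?rnorm_ge0// le_max lexx.
  rewrite -mulrA ler_wpM2l ?le_max ?lexx ?orbT//.
  by rewrite ler_wpM2r ?rnorm_ge0.
- move=> k xi eta; apply: ell2_eqP => n /=.
  by rewrite !fctE /= born_mulDr born_mulZr.
- by move=> xi a; apply: ell2_eqP => n /=; rewrite born_mulA.
Qed.

Definition diag_op (alpha : ell_infty) : bop := MkBop (diag_subproof alpha).

Lemma U_lift (f : Emb) (D : @disk R A) (xi : nat -> A)
    (x : nat -> disk_space D) : (forall n, disk_incl D (x n) = xi n) ->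
  forall n, disk_incl D (emb_act f x n) = emb_act f xi n.
Proof.
by move=> h n; rewrite /emb_act; case: emb_dagger => [m|]; rewrite ?linear0.
Qed.

Lemma U_ell2_subproof (f : Emb) (xi : ell2) :
  emb_act f (ell2_seq xi) \in ell2_pred.
Proof.
have [D [x [hx s]]] := ell2_lift (ell2P xi).
by apply: (mem_ell2 (U_lift f hx)); exact: le_lt_trans (l2sq_emb f x) s.
Qed.

Definition U_ell2 (f : Emb) (xi : ell2) : ell2 := MkEll2 (U_ell2_subproof f xi).

Lemma U_subproof (f : Emb) : U_ell2 f \in bop_pred.
Proof.
apply/asboolP; split.
- move=> D; exists D, 1 => xi x hx _; exists (emb_act f x).
    exact: U_lift.
  by rewrite mul1e; exact: l2sq_emb.
- move=> k xi eta; apply: ell2_eqP => n; rewrite /= /emb_act !fctE /=.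
  by case: emb_dagger => [m //|]; rewrite scaler0 addr0.
- move=> xi a; apply: ell2_eqP => n /=; rewrite /emb_act.
  by case: emb_dagger => [m //|]; rewrite born_mul0l.
Qed.

Definition U_op (f : Emb) : bop := MkBop (U_subproof f).

(** The matrix of an operator: the entry [(k, n)] is the [k]-th coordinate of
    the image of the [n]-th basis vector. *)
Definition bop_mx (T : bop) : nat -> nat -> A := fun k n => T (ell2_delta n) k.

End Ell2.
Arguments ell_infty {R} A.
Arguments bop {R} A.
Arguments U_op {R} A f.

Definition lspan (K : pzRingType) (V : lmodType K) (G : set V) : set V :=
  [set v | exists (n : nat) (c : 'I_n -> K) (g : 'I_n -> V),
    (forall i, G (g i)) /\ v = \sum_i c i *: g i].

Definition diagU_span (R : realType) (A : bornAlgType R)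
    (P : set (ell_infty A)) : set (bop A) :=
  lspan [set T | exists (alpha : ell_infty A) (f : Emb),
    P alpha /\ T = bop_comp (diag_op alpha) (U_op A f)].

Definition Gamma_infty (R : realType) (A : bornAlgType R) : set (bop A) :=
  diagU_span [set: ell_infty A].

(** As the sequences of a symmetric ideal are bounded, all elements of [S(A)]
    are elements of [ell_infty A]. *)
Definition I_S (R : realType) (S : set (nat -> R[i])) (A : bornAlgType R) :
    set (bop A) :=
  diagU_span [set alpha : ell_infty A | ideal_family S nat A alpha].
Arguments I_S {R} S A.

Lemma ideal_family_bounded (R : realType) (S : set (nat -> R[i]))
    (A : bornAlgType R) (alpha : nat -> A) :
  symmetric_ideal S -> ideal_family S nat A alpha ->
  disk_family A (@bounded_family R nat) alpha.
Proof.
move=> hS [D [b [hb [phi [psi phiK psiK] hphi]]]]; exists D, b; split=> //.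
have [M hM] := symid_bounded hS hphi; exists M => n.
by have := hM (psi n); rewrite /= psiK.
Qed.

Lemma I_S_sub_Gamma_infty (R : realType) (S : set (nat -> R[i]))
    (A : bornAlgType R) : I_S S A `<=` @Gamma_infty R A.
Proof.
move=> _ [n [c [g [hg ->]]]]; exists n, c, g; split=> // i.
by have [alpha [f [_ ->]]] := hg i; exists alpha, f.
Qed.

Definition N_mx (R : realType) (A : bornVectType R) (M : nat -> nat -> A) :
    \bar R :=
  ereal_sup ([set counting [set j | M i j != 0] | i in [set: nat]] `|`
             [set counting [set i | M i j != 0] | j in [set: nat]]).

(* Main.v *)
Require Import Defs.
From mathcomp Require Import all_boot all_order all_algebra.
From mathcomp Require Import complex finmap.
From mathcomp Require Import all_classical all_reals all_analysis.

Import Order.TTheory GRing.Theory Num.Theory.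
Import numFieldNormedType.Exports.

Local Open Scope classical_set_scope.
Local Open Scope ring_scope.

Set Implicit Arguments.
Unset Strict Implicit.
Unset Printing Implicit Defensive.

(** The entries of diag(alpha) U_f are the alpha_k, with k in ran(f), placed at
    the positions (k, n) with f(n) = k: at most one in each row and each column.
    Partial injections between countable sets preserve membership in S(X), so
    sums of such matrices satisfy both conditions. Conversely, if all rows and
    columns of M have at most N nonzero entries, sort the nonzero entries by
    their rank in their row and their rank in their column. Each of the N^2
    classes has at most one entry per row and per column, so it is the graph of
    some f in Emb, and M is the sum of N^2 operators diag(alpha) U_f. *)

(** * Partial injections and their inverses *)

Section PartialInjections.

Lemma emb_dagger_inj (f : Emb) m n k :
  emb_dagger f m = Some k -> emb_dagger f n = Some k -> m = n.
Proof. by move=> /emb_daggerP fm /emb_daggerP; rewrite fm => -[]. Qed.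

Definition emb_inverse (f : Emb) : Emb := MkEmb (@emb_dagger_inj f).

(** Pulling back along [f], with value 0 where [f] is undefined, is thus an action under which
    symmetric ideals are closed. *)
Lemma emb_act_inverse (V : nmodType) (f : Emb) (u : nat -> V) n :
  emb_act (emb_inverse f) u n = oapp u 0 (f n).
Proof.
have dagK m : emb_dagger (emb_inverse f) n = Some m <-> f n = Some m.
  by rewrite emb_daggerP /= emb_daggerP.
rewrite /emb_act; case fn: (f n) => [m|].
  by move/dagK: fn => ->.
by case E: emb_dagger => [m|//]; move/dagK: E; rewrite fn.
Qed.

Lemma emb_of_rel (P : nat -> nat -> Prop) :
  (forall m n n', P m n -> P m n' -> n = n') ->
  (forall m m' n, P m n -> P m' n -> m = m') ->
  exists f : Emb, forall m n, f m = Some n <-> P m n.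
Proof.
move=> Pfun Pinj.
have /choice[f fP] m : exists o : option nat, forall n, o = Some n <-> P m n.
  have [[n Pmn]|nP] := pselect (exists n, P m n).
    by exists (Some n) => n'; split=> [[<-]//|/(Pfun _ _ _ Pmn) ->].
  by exists None => n; split=> // Pmn; case: nP; exists n.
have finj m n k : f m = Some k -> f n = Some k -> m = n.
  by move=> /fP Pmk /fP; exact: Pinj.
by exists (MkEmb finj).
Qed.

End PartialInjections.

(** * Symmetric ideals and the families they define *)

Section SymmetricIdeals.
Variables (R : realType) (S : set (nat -> R[i])).
Hypothesis hS : symmetric_ideal S.

Lemma rnorm_eq0 (V : normedZmodType R[i]) (x : V) : rnorm x <= 0 -> x = 0.
Proof.
move=> x0; apply/eqP; rewrite -normr_eq0 -rnormE.
have -> : rnorm x = 0 by apply/eqP; rewrite eq_le x0 rnorm_ge0.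
by [].
Qed.

(** The quotient [v / u] is a bounded multiplier; where [u] vanishes, so does [v]. *)
Lemma symid_solid (u v : nat -> R[i]) (C : R) :
  S u -> (forall n, rnorm (v n) <= C * rnorm (u n)) -> S v.
Proof.
move=> Su vu; have -> : v = fun n => (v n / u n) * u n.
  apply/funext => n; have [un0|un0] := eqVneq (u n) 0; last by rewrite divfK.
  rewrite un0 mulr0; apply: rnorm_eq0.
  by rewrite (le_trans (vu n))// un0 rnorm0 mulr0.
(* [C] may be negative, while the quotient is 0 where [u] vanishes. *)
apply: symidM => //; exists (Num.max C 0) => n.
have [->|un0] := eqVneq (u n) 0.
  by rewrite invr0 mulr0 rnorm0 le_max lexx orbT.
have run0 : 0 < rnorm (u n).
  by rewrite lt_neqAle rnorm_ge0 andbT eq_sym -(inj_eq (@complexI R)) rnormE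
             normr_eq0.
have -> : rnorm (v n / u n) = rnorm (v n) / rnorm (u n).
  by apply: complexI; rewrite rmorphM/= fmorphV/= !rnormE normf_div.
by rewrite ler_pdivrMr// (le_trans (vu n))// ler_wpM2r ?rnorm_ge0// le_max lexx.
Qed.

(* [r] is the inverse of a partial injection from [X] to [Y]. *)
Lemma transport_pinj (X Y : Type) (chi : nat -> Y) (r : Y -> option X)
    (u : X -> R[i]) :
  bijective chi ->
  (forall y y' x, r y = Some x -> r y' = Some x -> y = y') ->
  transport S X u -> S (oapp u 0 \o r \o chi).
Proof.
move=> /bij_inj chi_inj rinj [phi [psi phiK psiK] Su].
have finj m n k : omap psi (r (chi m)) = Some k ->
    omap psi (r (chi n)) = Some k -> m = n.
  case rm: (r (chi m)) => [x|//] [<-]; case rn: (r (chi n)) => [x'|//].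
  move=> [/(can_inj psiK) xx']; apply: chi_inj.
  by apply: (rinj _ _ x) => //; rewrite rn xx'.
(* Read through [chi] and [psi], [r] becomes an element of [Emb] whose inverse acts on
   [u \o phi]. *)
rewrite (_ : _ \o chi = emb_act (emb_inverse (MkEmb finj)) (u \o phi)).
  exact: symid_act.
apply/funext => n; rewrite emb_act_inverse /=.
by case: (r (chi n)) => //= x; rewrite psiK.
Qed.

Lemma transport_bij (X : Type) (phi : nat -> X) (u : X -> R[i]) :
  bijective phi -> transport S X u -> S (u \o phi).
Proof.
by move=> hphi; apply: (@transport_pinj X X phi Some u) => // ? ? ? [->] [].
Qed.

Variable A : bornVectType R.

(** Extending the lift by 0 stays in the same disk, so only the norms have to be transported. This
    serves both to spread a diagonal over a matrix and to extract a diagonal from one. *)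
Lemma ideal_family_pinj (X Y : Type) (chi : nat -> Y) (r : Y -> option X)
    (a : X -> A) :
  bijective chi ->
  (forall y y' x, r y = Some x -> r y' = Some x -> y = y') ->
  ideal_family S X A a -> ideal_family S Y A (oapp a 0 \o r).
Proof.
move=> hchi rinj [D [b [hb hu]]]; exists D, (oapp b 0 \o r); split=> [y /=|].
  by case: (r y) => [x|] /=; rewrite ?linear0.
exists chi => //; have := transport_pinj hchi rinj hu; congr S.
by apply/funext => n /=; case: (r _) => //=; rewrite normr0.
Qed.

Lemma ideal_family0 (X : Type) (phi : nat -> X) :
  bijective phi -> ideal_family S X A (fun=> 0).
Proof.
move=> hphi; have [D _] := @disk_cover R A 0.
exists D, (fun=> 0); split=> [x|]; first exact: linear0.
exists phi => //; have := symid0 hS; congr S.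
by apply/funext => n /=; rewrite normr0.
Qed.

Lemma ideal_familyP (X : Type) (c : R[i]) (a1 a2 : X -> A) :
  ideal_family S X A a1 -> ideal_family S X A a2 ->
  ideal_family S X A (fun x => c *: a1 x + a2 x).
Proof.
move=> [D1 [b1 [hb1 [phi phi_bij S1]]]] [D2 [b2 [hb2 S2]]].
have [D [i1 i2]] := disk_filtering D1 D2.
have [d1 [C1 h1]] := lift_inclusion b1 i1.
have [d2 [C2 h2]] := lift_inclusion b2 i2.
exists D, (fun x => c *: d1 x + d2 x); split=> [x|].
  by rewrite linearP (h1 x).1 (h2 x).1 hb1 hb2.
exists phi => //.
(* The second family may come with another bijection and is first moved to [phi]. *)
have S12 := symidD hS S1 (transport_bij phi_bij S2).
apply: (symid_solid (C := `|rnorm c * C1| + `|C2|) S12) => n /=.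
set x := phi n; rewrite rnorm_id.
have -> : rnorm (`|b1 x| + `|b2 x| : R[i]) = rnorm (b1 x) + rnorm (b2 x).
  by apply: complexI; rewrite rmorphD/= !rnormE ger0_norm// addr_ge0.
apply: le_trans (rnormD _ _) _; rewrite rnormZ mulrDr.
have := ler_wpM2l (rnorm_ge0 c) (h1 x).2; have := (h2 x).2.
have := rnorm_ge0 (b1 x); have := rnorm_ge0 (b2 x).
move: (rnorm (b1 x)) (rnorm (b2 x)) => p q q0 p0 l2 l1; apply: lerD.
  rewrite (le_trans l1)// mulrA ler_wpM2r//.
  by rewrite (le_trans (ler_norm _))// lerDl.
rewrite (le_trans l2)// ler_wpM2r//.
by rewrite (le_trans (ler_norm _))// lerDr.
Qed.

End SymmetricIdeals.

(** * Counting nonzero entries, and ranks *)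

Section Counting.

(** An infinite set contains [N.+1] distinct points, so duplicate-free lists detect the bound. *)
Lemma counting_leP (R : realType) (T : choiceType) (X : set T) (N : nat) :
  (counting X <= (N%:R : R)%:E)%E <->
  forall s : seq T, uniq s -> {in s, forall x, X x} -> (size s <= N)%N.
Proof.
rewrite /counting; split=> [|sN].
  case: ifPn => [/asboolP Xfin|_]; last by rewrite leNgt ltry.
  rewrite lee_fin ler_nat => le_XN s us sX; apply: leq_trans le_XN.
  apply: uniq_leq_size => // x xs; rewrite in_fset_set// mem_set//.
  exact: sX.
case: ifPn => [/asboolP Xfin|/asboolP Xinf].
  rewrite lee_fin ler_nat; apply: sN => [|x]; first exact: fset_uniq.
  by rewrite in_fset_set// => /set_mem.
have [B BX NB] := infinite_set_fset N.+1 Xinf.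
have := sN B (fset_uniq B) BX.
by rewrite leqNgt NB.
Qed.

Lemma uniq_size_le1 (T : eqType) (p : pred T) (s : seq T) :
  (forall x y, p x -> p y -> x = y) -> uniq s -> all p s -> (size s <= 1)%N.
Proof.
move=> pinj; case: s => [|x [|y s]]//= /andP[+ _] /and3P[px py _].
by rewrite inE (pinj x y px py) eqxx.
Qed.

Lemma count_iota_lt (p : pred nat) (j k : nat) :
  p j -> (j < k)%N -> (count p (iota 0 j) < count p (iota 0 k))%N.
Proof.
move=> pj jk; rewrite -(subnKC jk) iotaD count_cat -(addn1 j) iotaD count_cat /= pj.
by rewrite addn0 -[X in (X <= _)%N]addn1 leq_addr.
Qed.

(** The count is the rank of a point among the solutions of [p], and it increases strictly along
    them. *)
Lemma count_iota_inj (p : pred nat) (j k : nat) :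
  p j -> p k -> count p (iota 0 j) = count p (iota 0 k) -> j = k.
Proof.
move=> pj pk jk; have [/(count_iota_lt pj)|/(count_iota_lt pk)|//] := ltngtP j k;
  by rewrite jk ltnn.
Qed.

Variables (R : realType) (A : bornVectType R).
Implicit Type M : nat -> nat -> A.

(** Columns are treated by applying this to the transpose. *)
Definition rows_le M (N : nat) : Prop :=
  forall i s, uniq s -> all (fun j => M i j != 0) s -> (size s <= N)%N.

Lemma rows_leW M m n : (m <= n)%N -> rows_le M m -> rows_le M n.
Proof. by move=> mn hM i s us /(hM i s us) /leq_trans; exact. Qed.

(** The support of a combination lies in the union of the two supports. *)
Lemma rows_leP (c : R[i]) M1 M2 N1 N2 : rows_le M1 N1 -> rows_le M2 N2 ->
  rows_le (fun i j => c *: M1 i j + M2 i j) (N1 + N2).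
Proof.
move=> h1 h2 i s us /allP sM.
pose p1 j := M1 i j != 0; pose p2 j := M2 i j != 0.
have : all (predU p1 p2) s.
  apply/allP => j /sM; apply: contraNT; rewrite /= negb_or !negbK.
  by move=> /andP[/eqP-> /eqP->]; rewrite scaler0 addr0.
rewrite all_count => /eqP <-.
apply: (leq_trans (leq_addr (count (predI p1 p2) s) _)).
rewrite count_predUI -!size_filter leq_add//.
  by apply: (h1 i); rewrite ?filter_uniq ?filter_all.
by apply: (h2 i); rewrite ?filter_uniq ?filter_all.
Qed.

(** Ranks start at 0: the entry at [j] itself is one more nonzero entry, hence the strict bound. *)
Lemma count_iota_rows_lt M N i j : rows_le M N -> M i j != 0 ->
  (count (fun l => M i l != 0%R) (iota 0 j) < N)%N.
Proof.
move=> hM Mij; apply: leq_trans (count_iota_lt Mij (ltnSn j)) _.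
by rewrite -size_filter; apply: (hM i); rewrite ?filter_uniq ?iota_uniq ?filter_all.
Qed.

Lemma counting_rows_le M N :
  rows_le M N <-> forall i, (counting [set j | M i j != 0%R] <= (N%:R : R)%:E)%E.
Proof.
split=> [hM i|hM i s us /allP sM].
  by apply/counting_leP => s us sM; apply: (hM i) => //; apply/allP.
by have /counting_leP := hM i; apply.
Qed.

Lemma N_mx_finP M : (N_mx M < +oo)%E <->
  exists N, rows_le M N /\ rows_le (fun j i => M i j) N.
Proof.
split=> [Mfin|[N [/counting_rows_le hr /counting_rows_le hc]]]; last first.
  apply: (@le_lt_trans _ _ (N%:R : R)%:E); last exact: ltry.
  by apply: ge_ereal_sup => _ [[i _ <-]|[j _ <-]].
have [N hN] : exists N : nat, (N_mx M <= (N%:R : R)%:E)%E.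
  case: (N_mx M) Mfin => [x _|//|_]; last by exists 0%N; rewrite leNye.
  exists (Num.bound `|x|); rewrite lee_fin.
  by rewrite (le_trans (ler_norm x))// ltW// archi_boundP.
by exists N; split; apply/counting_rows_le => i; apply: le_trans hN;
  apply: ereal_sup_ubound; [left|right]; exists i.
Qed.

End Counting.

(** * Linear spans *)

Section Span.
Variables (K : pzRingType) (V : lmodType K) (G : set V).

Lemma lspan_ind (P : V -> Prop) :
  P 0 -> (forall c x y, G x -> P y -> P (c *: x + y)) ->
  forall v, lspan G v -> P v.
Proof.
move=> P0 PD _ [n [c [g [Gg ->]]]].
by elim/big_rec: _ => // i y _; exact: PD.
Qed.

Lemma lspan_sum (I : finType) (g : I -> V) :
  (forall i, G (g i)) -> lspan G (\sum_i g i).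
Proof.
move=> Gg; exists #|I|, (fun=> 1), (g \o enum_val); split=> [i|]; first exact: Gg.
rewrite (@big_enum_val _ _ _ I predT); apply: eq_bigr => i _ /=.
by rewrite scale1r.
Qed.

End Span.

(** * Matrices of operators and their injectivity *)

Section Matrices.
Variables (R : realType) (A : bornAlgType R).

Lemma bop_mxP (c : R[i]) (T1 T2 : bop A) k n :
  bop_mx (c *: T1 + T2) k n = c *: bop_mx T1 k n + bop_mx T2 k n.
Proof. by []. Qed.

Lemma bop_mx0 k n : bop_mx (0 : bop A) k n = 0.
Proof. by []. Qed.

Lemma bop_mx_sum (I : finType) (T : I -> bop A) k n :
  bop_mx (\sum_i T i) k n = \sum_i bop_mx (T i) k n.
Proof. by apply: (big_morph (fun T : bop A => bop_mx T k n)). Qed.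

(** [U_f] sends the basis vector at [n] to the one at [f n], or to 0, and the diagonal then scales
    coordinate [k]. *)
Lemma bop_mx_diagU (alpha : ell_infty A) (f : Emb) k n :
  bop_mx (bop_comp (diag_op alpha) (U_op A f)) k n =
  if f n == Some k then alpha k else 0.
Proof.
rewrite /bop_mx /= /emb_act /=; case: eqP => [/emb_daggerP ->|fnk].
  by rewrite eqxx born_mul1r.
case E: emb_dagger => [m|]; last by rewrite born_mul0r.
case: eqP => [mn|_]; last by rewrite born_mul0r.
by move/emb_daggerP: E; rewrite mn.
Qed.

Lemma l2sq_tail_le (V : normedZmodType R[i]) N (x : nat -> V) :
  (l2sq (fun n => if (n < N)%N then 0%R else x n) <= l2sq x)%E.
Proof.
rewrite -[leRHS]mul1e -[1%E]/(1%:E) -[1](expr1n _ 2).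
by apply: l2sq_le => n; rewrite mul1r; case: ifP; rewrite ?rnorm0 ?rnorm_ge0.
Qed.

Lemma ell2_tail_subproof (N : nat) (xi : ell2 A) :
  (fun n => if (n < N)%N then 0 else ell2_seq xi n) \in @ell2_pred R A.
Proof.
have [D [x [hx s]]] := ell2_lift (ell2P xi).
apply: (@mem_ell2 _ _ _ D (fun n => if (n < N)%N then 0 else x n)) => [n|].
  by case: ifP; rewrite ?linear0.
exact: le_lt_trans (l2sq_tail_le N x) s.
Qed.

Definition ell2_tail N xi : ell2 A := MkEll2 (ell2_tail_subproof N xi).

Lemma ell2_tail0 xi : ell2_tail 0 xi = xi.
Proof. by apply: ell2_eqP => n /=. Qed.

(** The split-off term is a right multiple of a basis vector; the coefficient 1 matches the form in
    which linearity is stated. *)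
Lemma ell2_tailS N (xi : ell2 A) :
  ell2_tail N xi =
  1 *: ell2_rmul (ell2_delta A N) (xi N) + ell2_tail N.+1 xi.
Proof.
apply: ell2_eqP => n; rewrite ell2_linE /= scale1r ltnS.
have [nN|Nn|->] := ltngtP n N; rewrite ?ltnn ?eqxx.
- by rewrite born_mul0l addr0.
- by rewrite born_mul0l add0r.
- by rewrite born_mul1l addr0.
Qed.

Lemma l2sq_tail_cvg (V : normedZmodType R[i]) (x : nat -> V) :
  (l2sq x < +oo)%E ->
  l2sq (fun n => if (n < N)%N then 0 else x n) @[N --> \oo] --> (0 : \bar R)%E.
Proof.
move=> xfin; have ge0 k : (0 <= (rnorm (x k) ^+ 2)%:E)%E.
  by rewrite lee_fin sqr_ge0.
apply: cvg_trans (nneseries_tail_cvg xfin (fun k _ => ge0 k)).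
apply: near_eq_cvg; apply: nearW => N; rewrite eseries_cond eseries_mkcond.
apply: eq_eseriesr => n _ /=.
by rewrite leqNgt; case: ltnP => _ //=; rewrite rnorm0 expr0n.
Qed.

(* [T] takes the same value at [xi] and at all its tails, since it kills the
   basis vectors; the tails tend to [0] in the norm of a single disk. *)
Lemma bop_mx_eq0 (T : bop A) : (forall k n, bop_mx T k n = 0) -> T = 0.
Proof.
move=> T0; have /asboolP[Tb Tl Tr] := bopP T.
apply: val_inj; apply/funext => xi; apply: ell2_eqP => k /=.
have T_tail N : T (ell2_tail N xi) = T xi.
  elim: N => [|N <-]; first by rewrite ell2_tail0.
  rewrite [in RHS]ell2_tailS Tl Tr; apply: ell2_eqP => n.
  by rewrite ell2_linE /= (T0 n N : T _ n = 0) born_mul0l scaler0 add0r.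
have [D [x [hx xfin]]] := ell2_lift (ell2P xi).
(* [D'] and [C] depend on [D] only, so they serve all the tails at once. *)
have [D' [C TC]] := Tb D.
pose xt N n := if (n < N)%N then 0 else x n.
have bound N : exists2 y : nat -> disk_space D',
    (forall n, disk_incl D' (y n) = T xi n) & (l2sq y <= C%:E * l2sq (xt N))%E.
  have [||y hy yC] := TC (ell2_tail N xi) (xt N).
  - by move=> n; rewrite /xt /=; case: ifP; rewrite ?linear0.
  - exact: le_lt_trans (l2sq_tail_le N x) xfin.
  by exists y => // n; rewrite hy T_tail.
have [y hy _] := bound 0%N.
rewrite -[LHS]hy (_ : y k = 0) ?linear0//; apply: rnorm_eq0.
have sqr_le N : ((rnorm (y k) ^+ 2)%:E <= C%:E * l2sq (xt N))%E.
  have [y' hy' y'C] := bound N; apply: le_trans y'C.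
  (* Lifts to [D'] are unique, so one [y] satisfies the bounds for every [N]. *)
  have -> : y' = y.
    by apply/funext => n; apply: (@disk_incl_inj R A); rewrite hy hy'.
  rewrite /l2sq (@sequences.nneseriesD1 R _ k xpredT)// => [|n _]; last first.
    by rewrite lee_fin sqr_ge0.
  by rewrite leeDl// nneseries_ge0// => n _ _; rewrite lee_fin sqr_ge0.
have : ((rnorm (y k) ^+ 2)%:E <= C%:E * 0)%E.
  have := @cvgeZl _ _ _ _ _ C%:E isT (l2sq_tail_cvg xfin).
  apply: cvge_ge.
  by apply: nearW => N; exact: sqr_le.
rewrite mule0 lee_fin => /(le_trans _) yk.
by rewrite -(@ler_pXn2r _ 2)// ?nnegrE ?rnorm_ge0// expr0n yk.
Qed.

Lemma bop_mx_inj : injective (@bop_mx R A).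
Proof.
move=> T1 T2 T12; apply/eqP; rewrite -subr_eq0; apply/eqP/bop_mx_eq0 => k n.
by rewrite addrC -scaleN1r bop_mxP T12 scaleN1r addNr.
Qed.

End Matrices.

(** * The two inclusions *)

Unset Implicit Arguments.

(* The injectivity of [bop_mx] is the identification of operators with
   matrices. *)
Theorem proposition3p12 (R : realType) (A : bornAlgType R)
    (S : set (nat -> R[i])) (hS : symmetric_ideal S) :
  injective (@bop_mx R A) /\
  [set bop_mx T | T in I_S S A] =
  [set M : nat -> nat -> A |
    ideal_family S (nat * nat)%type A (fun p => M p.1 p.2) /\
    (N_mx M < +oo)%E].
Proof.
have [chi chi_bij] : exists chi : nat -> nat * nat, bijective chi.
  have /card_set_bijP[chi] : ([set: nat] #= [set: nat * nat])%card.
    by rewrite card_eq_sym card_nat2.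
  by rewrite setTT_bijective; exists chi.
split; first exact: bop_mx_inj.
apply/seteqP; split=> [_ [T IT <-]|M [/= SM /N_mx_finP[N [hr hc]]]].
  suff [ST [N hN]] : ideal_family S _ A (fun p => bop_mx T p.1 p.2) /\
    exists N, rows_le (bop_mx T) N /\ rows_le (fun j i => bop_mx T i j) N.
    by split=> //; apply/N_mx_finP; exists N.
  (* Both conditions survive linear combinations, which leaves a single generator to examine. *)
  move: T IT; apply: lspan_ind =>
    [|c _ T [alpha [f [Salpha ->]]] [ST [N [hr hc]]]].
    split; first exact: ideal_family0 chi_bij.
    by exists 0%N; split=> i [|j s]//= _; rewrite bop_mx0 eqxx.
  set G := bop_comp _ _.
  have -> : bop_mx (c *: G + T) = fun i j => c *: bop_mx G i j + bop_mx T i j.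
    by apply/funext => i; apply/funext => j; exact: bop_mxP.
  split.
    suff SG : ideal_family S _ A (fun p => bop_mx G p.1 p.2).
      exact: (ideal_familyP hS c SG ST).
    (* An occupied position is sent to its row; as [f] is injective, no row is hit twice. *)
    pose r (p : nat * nat) := if f p.2 == Some p.1 then Some p.1 else None.
    have rinj p q k : r p = Some k -> r q = Some k -> p = q.
      rewrite /r; case: eqP => // fp [<-]; case: eqP => // fq [qp].
      case: p q fp fq qp => [k1 n1] [k2 n2] /= f1 f2 k12; rewrite k12 in f2 *.
      by rewrite (emb_inj f1 f2).
    have := ideal_family_pinj hS chi_bij rinj Salpha; congr ideal_family.
    by apply/funext => -[i j] /=; rewrite bop_mx_diagU /r /=; case: ifP.
  have Gf i j : bop_mx G i j != 0 -> f j = Some i.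
    by rewrite bop_mx_diagU; case: ifP => [/eqP//|_]; rewrite eqxx.
  exists (1 + N)%N; split; apply: rows_leP => // i s; apply: uniq_size_le1.
    by move=> j j' /Gf fj /Gf fj'; exact: emb_inj fj fj'.
  by move=> j j' /Gf + /Gf; move=> -> [].
pose rk i j := count (fun l => M i l != 0) (iota 0 j).
pose ck i j := count (fun l => M l j != 0) (iota 0 i).
have rk_lt i j : M i j != 0 -> (rk i j < N)%N by exact: count_iota_rows_lt.
have ck_lt i j : M i j != 0 -> (ck i j < N)%N.
  exact: (@count_iota_rows_lt _ _ _ _ j i hc).
(* The column [n] comes first because [f] maps columns to rows. *)
pose P (t : 'I_N * 'I_N) n k := [/\ M k n != 0, rk k n = t.1 & ck k n = t.2].
have /choice[f fP] t : exists f : Emb, forall n k, f n = Some k <-> P t n k.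
  (* The column rank makes the relation single-valued, the row rank makes it injective. *)
  apply: emb_of_rel =>
    [n k k' [Mk _ ck1] [Mk' _ ck2]|n n' k [Mn rk1 _] [Mn' rk2 _]].
    apply: (@count_iota_inj (fun l => M l n != 0)) => //.
    exact: etrans ck1 (esym ck2).
  apply: (@count_iota_inj (fun l => M k l != 0)) => //.
  exact: etrans rk1 (esym rk2).
(* The only entry of class [t] in row [k], or 0 if there is none. *)
pose a t k := oapp (fun p => M p.1 p.2) 0 (omap (pair k) (emb_dagger (f t) k)).
have Sa t : ideal_family S nat A (a t).
  (* The position of that entry has first coordinate [k], so distinct rows give distinct
     positions. *)
  have nat_bij : bijective (@id nat) by exists id.
  apply: (ideal_family_pinj hS nat_bij _ SM) => k k' [i j].
  by case: emb_dagger => //= ? [<- _]; case: emb_dagger => //= ? [<-].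
pose alpha t := MkEllInfty (ideal_family_bounded hS (Sa t)).
exists (\sum_t bop_comp (diag_op (alpha t)) (U_op A (f t))).
  by apply: lspan_sum => t; exists (alpha t), (f t); split=> //; exact: Sa.
apply/funext => k; apply/funext => n; rewrite bop_mx_sum.
have entry t : bop_mx (bop_comp (diag_op (alpha t)) (U_op A (f t))) k n =
    if f t n == Some k then M k n else 0.
  rewrite bop_mx_diagU; case: eqP => // /emb_daggerP ftn.
  by rewrite /= /a ftn.
under eq_bigr do rewrite entry.
have [Mkn|Mkn] := eqVneq (M k n) 0; first by rewrite Mkn big1// => t _; case: ifP.
(* The class of the entry at [(k, n)] is the only one contributing to the sum. *)
pose t0 := (Ordinal (rk_lt _ _ Mkn), Ordinal (ck_lt _ _ Mkn)).
rewrite (bigD1 t0)//= big1 ?addr0 => [|t tt0].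
  by have /fP -> : P t0 n k by []; rewrite eqxx.
case: eqP => // /fP[_ t1 t2]; case/eqP: tt0.
by case: t t1 t2 => [t1 t2] /= e1 e2; congr pair; apply: val_inj.
Qed.
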